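(* Let $n\to\infty$. Fix integers $k\ge 1$ and $2\le d_1<d_2<\dots<d_k$ and real numbers $\delta_1,\dots,\delta_k\in(0,1)$ (all independent of $n$). On the vertex set $[n]=\{1,\dots,n\}$, for each $i\in\{1,\dots,k\}$ include each $d_i$-element subset of $[n]$ as a hyperedge of degree $d_i$ independently with probability $p_i=n^{1-d_i+\delta_i+o(1)}$, all hyperedges (across all degrees) being independent. Let $\psi$ be the projected graph on $[n]$: $\{u,v\}$ is an edge of $\psi$ if and only if some hyperedge (of any degree) contains both $u$ and $v$. Fix $j$ with $d_j\ge 3$, let $\mathcal{H}_j$ be the (random) set of hyperedges of degree $d_j$, and let $\delta^*=\max\{\delta_1,\dots,\delta_k\}$. Suppose $$\delta^*<\frac{d_j-2}{d_j}+\frac{2\delta_j}{d_j(d_j-1)}.$$ Let $\widehat{\mathcal{H}}_j$ be the set of all maximal cliques of $\psi$ of size $d_j$ (i.e., all $d_j$-element vertex sets that span a clique in $\psi$ and are not contained in any larger clique of $\psi$). Then $$\mathbb{E}\left[\left|\mathcal{H}_j\,\triangle\,\widehat{\mathcal{H}}_j\right|\right]=o(1)\,\mathbb{E}\left[\left|\mathcal{H}_j\right|\right].$$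
   Context: The notation $n^{a+o(1)}$ denotes a quantity $n^{a+\epsilon_n}$ with $\epsilon_n\to 0$ as $n\to\infty$; $o(1)$ denotes a quantity tending to $0$ as $n\to\infty$. $\triangle$ denotes symmetric difference of sets. *)

(* Defs.v *)
From mathcomp Require Import all_boot all_order all_algebra.
From mathcomp Require Import all_classical all_reals all_analysis.

Set Implicit Arguments.
Unset Strict Implicit.
Unset Printing Implicit Defensive.

Import Order.TTheory GRing.Theory Num.Theory.
Import numFieldNormedType.Exports.

Local Open Scope ring_scope.

(* A hypergraph on a vertex type V is a set of hyperedges H : {set {set V}}; *)
(* the degree of a hyperedge is its cardinality.                             *)

Definition symdiff (T : finType) (A B : {set T}) : {set T} :=
  (A :\: B) :|: (B :\: A).

Section Deterministic.
Variable V : finType.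
Implicit Types (H : {set {set V}}) (S e : {set V}).

Definition edges_of_degree (m : nat) H : {set {set V}} :=
  [set e in H | #|e| == m].

Definition projected_graph H : rel V :=
  fun u v => (u != v) && [exists e in H, (u \in e) && (v \in e)].

Definition is_clique (G : rel V) S : bool :=
  [forall u in S, forall v in S, (u != v) ==> G u v].

Definition maximal_cliques (G : rel V) (m : nat) : {set {set V}} :=
  [set S : {set V} | maxset (is_clique G) S & #|S| == m].

End Deterministic.

Section RandomHypergraph.
Variables (R : realType) (k : nat) (d : 'I_k -> nat) (n : nat).
Variable p : 'I_k -> R.

Definition potential_hyperedges : {set {set 'I_n}} :=
  [set e : {set 'I_n} | [exists i, #|e| == d i]].

(* The probability of the outcome H, for H \subset potential_hyperedges,     *)
(* when the hyperedges are chosen independently, those of degree d i with    *)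
(* probability p i. For injective d the index i is determined by #|e|, so    *)
(* that each potential hyperedge contributes exactly one factor.             *)
Definition hypergraph_prob (H : {set {set 'I_n}}) : R :=
  \prod_(i < k) \prod_(e : {set 'I_n} | #|e| == d i)
    (if e \in H then p i else 1 - p i).

Definition hypergraph_expectation (X : {set {set 'I_n}} -> R) : R :=
  \sum_(H : {set {set 'I_n}} | H \subset potential_hyperedges)
    hypergraph_prob H * X H.

Lemma hypergraph_expectation_cst (c : R) : injective d -> hypergraph_expectation (fun=> c) = c.
Proof.
move=> d_inj; rewrite /hypergraph_expectation -mulr_suml.
pose q (e : {set 'I_n}) : R := \sum_(i < k | #|e| == d i) p i.
have qE i (e : {set 'I_n}) : #|e| == d i -> q e = p i.
  move=> /eqP ei; rewrite /q (bigD1 i) ?ei//= big1 ?addr0// => j.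
  by case/andP=> /eqP/d_inj ->; rewrite eqxx.
suff -> : \sum_(H : {set {set 'I_n}} | H \subset potential_hyperedges)
    hypergraph_prob H = 1 by rewrite mul1r.
have <- : \prod_(e : {set 'I_n}) (q e + (1 - q e)) = 1.
  by apply: big1 => e _; rewrite addrC subrK.
rewrite bigA_distr.
rewrite [RHS](bigID (fun H : {set {set 'I_n}} =>
  H \subset potential_hyperedges))/=.
rewrite [X in _ = _ + X]big1 ?addr0; last first.
  move=> H /subsetPn[e eH eP]; rewrite (bigD1 e)//= eH /q big1 ?mul0r// => i ei.
  by move: eP; rewrite inE => /existsP[]; exists i.
apply: eq_bigr => H HP.
rewrite [RHS](bigID (mem potential_hyperedges))/=.
rewrite [X in _ = _ * X]big1 ?mulr1; last first.
  move=> e eP; case: ifPn => [eH|_]; first by rewrite (fintype.subsetP HP _ eH) in eP.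
  rewrite /q big1 ?subr0// => i ei.
  by move: eP; rewrite inE => /existsP[]; exists i.
rewrite /hypergraph_prob.
transitivity (\prod_(i < k) \prod_(e : {set 'I_n} | #|e| == d i)
    (if e \in H then q e else 1 - q e)).
  by apply: eq_bigr => i _; apply: eq_bigr => e /qE ->.
rewrite (exchange_big_dep (mem potential_hyperedges))/=; last first.
  by move=> i e _ ei; rewrite inE; apply/existsP; exists i.
apply: eq_bigr => e; rewrite inE => /existsP[i ei].
rewrite (big_pred1 i)// => j /=; rewrite (eqP ei) eq_sym.
by apply/eqP/eqP => [/d_inj|->].
Qed.

End RandomHypergraph.

(* Main.v *)
Require Import Defs.
From mathcomp Require Import all_boot all_order all_algebra.
From mathcomp Require Import all_classical all_reals all_analysis.
From mathcomp Require Import lra ring.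
Set Implicit Arguments.
Unset Strict Implicit.
Unset Printing Implicit Defensive.
Import Order.TTheory GRing.Theory Num.Theory.
Import numFieldNormedType.Exports.
Local Open Scope ring_scope.

(** The two kinds of errors are bounded by an exponential-moment argument.  Fix
    a set [S] of [d_j] vertices.

    If [S] is a hyperedge but not a maximal clique, then for some vertex [v]
    outside [S] the hyperedges through [v] cover [S], so the sum over them of
    [#|e :&: S|] is at least [d_j].  If [S] is a maximal clique but not a
    hyperedge, then no hyperedge contains [S] (it would be a larger clique),
    and the hyperedges meeting [S] in a proper subset cover all pairs of [S],
    so the sum over them of ['C(#|e :&: S|, 2)] is at least ['C(d_j, 2)].

    By Markov's inequality the probability of either event is at most
    [n^(- c t) * 'E[n^(c W)]], where [W] is the sum and [t] its lower bound.
    Independence turns the moment into a product of factors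
    [1 + p_e (n^(c w_e) - 1)], whose logarithm stays bounded provided that
    [1 + delta_i - #|A| + c w(A) < 0] for every possible trace [A].  For the
    second event this exponent is convex in [#|A|], so that only the traces of
    sizes [2] and [d_j - 1] matter; the former produces exactly the hypothesis
    on [delta^*]. *)

(** * Covering and counting bounds for finite sets *)

(** Double counting of the pairs [(e, x)] with [r e x]: each [x] of [D] occurs in at least one of
    them. *)
Lemma leq_card_cover (I T : finType) (D : {set T}) (F : {set I})
    (r : I -> pred T) :
  (forall x, x \in D -> exists2 e, e \in F & r e x) ->
  (#|D| <= \sum_(e in F) #|[set x in D | r e x]|)%N.
Proof.
move=> cov.
have -> : #|D| = (\sum_(x in D) 1)%N by rewrite sum1_card.
have -> : (\sum_(e in F) #|[set x in D | r e x]|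
           = \sum_(e in F) \sum_(x in D) r e x)%N.
  apply: eq_bigr => e _; rewrite -sum1_card.
  rewrite (eq_bigl (fun x => (x \in D) && r e x)); last by move=> x; rewrite inE.
  by rewrite -big_mkcondr; apply: eq_bigr => x; case: (r e x).
rewrite exchange_big /=; apply: leq_sum => x /cov[e eF rex].
by rewrite (bigD1 e) //= rex.
Qed.

Lemma leq_bin_expn n m : ('C(n, m) <= n ^ m)%N.
Proof.
apply: leq_trans (leq_pmulr _ (fact_gt0 m)) _.
rewrite bin_ffact; elim: m n => [|m IHm] [|n] //.
rewrite ffactSS expnS leq_mul2l (leq_trans (IHm n)) ?orbT //.
by case: m {IHm} => // m; rewrite leq_exp2r.
Qed.

(** Removing [A] is injective on the supersets of [A] and lands in the sets of size [m - #|A|]. The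
    multiplied form stays meaningful when [m < #|A|], where no superset exists. *)
Lemma card_supersets (n m : nat) (A : {set 'I_n}) :
  (#|[set e : {set 'I_n} | (#|e| == m) && (A \subset e)]| * n ^ #|A|
   <= n ^ m)%N.
Proof.
set F := [set e | _].
have [ltmA|leAm] := ltnP m #|A|.
  suff -> : F = finset.set0 by rewrite cards0.
  apply/setP => e; rewrite !inE; apply/negP => /andP[/eqP em /subset_leq_card].
  by rewrite em leqNgt ltmA.
have injD : {in F &, injective (fun e => e :\: A)}.
  move=> e f; rewrite !inE => /andP[_ /finset.setIidPr eA] /andP[_ /finset.setIidPr fA] eq_ef.
  by rewrite -(finset.setID e A) -(finset.setID f A) eA fA eq_ef.
rewrite -(card_in_imset injD) -[in X in (_ <= X)%N](subnK leAm) expnD leq_mul2r.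
apply/orP; right; apply: leq_trans (leq_bin_expn n (m - #|A|)).
have -> : 'C(n, m - #|A|) = #|[set B : {set 'I_n} | #|B| == m - #|A|]|%N.
  by rewrite card_draws card_ord.
apply: subset_leq_card.
apply/fintype.subsetP => B /imsetP[e]; rewrite !inE => /andP[/eqP <- sAe] ->.
by rewrite cardsD (finset.setIidPr sAe).
Qed.

(** * Deterministic description of the two kinds of errors *)

Section Deterministic.
Variable V : finType.
Implicit Types (H : {set {set V}}) (S e : {set V}).

Lemma hyperedge_clique H e : e \in H -> is_clique (projected_graph H) e.
Proof.
move=> eH; apply/'forall_implyP => u ue; apply/'forall_implyP => v ve.
apply/implyP => uv; rewrite /projected_graph uv /=.
by apply/existsP; exists e; rewrite eH ue ve.
Qed.

Definition extends H S (v : V) : bool :=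
  [&& S \in H, v \notin S & [forall u in S, projected_graph H u v]].

Definition spurious H S : bool :=
  (S \notin H) && maxset (is_clique (projected_graph H)) S.

(** A hyperedge that is not a maximal clique lies properly inside some clique, and any further
    vertex of that clique extends it. Several [v] may do so, hence only an inequality. *)
Lemma leq_symdiff H m :
  (#|symdiff (edges_of_degree m H) (maximal_cliques (projected_graph H) m)|
   <= \sum_(S : {set V} | #|S| == m) (\sum_(v : V) extends H S v + spurious H S))%N.
Proof.
rewrite -sum1_card big_mkcond [X in (_ <= X)%N]big_mkcond /=.
apply: leq_sum => S _; rewrite !inE; case: (#|S| == m); rewrite ?andbT ?andbF //=.
rewrite /spurious; have [SH|_] /= := boolP (S \in H); last first.
  by rewrite ?andbF ?orbF /=; case: maxset; rewrite ?addn1.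
rewrite ?andbF ?orbF ?andbT; case: (boolP (maxset _ S)) => //= nmax.
suff [v ev] : exists v, extends H S v by rewrite (bigD1 v) //= ev.
have Scl := hyperedge_clique SH.
have /existsP[B] : [exists B, is_clique (projected_graph H) B && (S \proper B)].
  apply: contraR nmax; rewrite negb_exists => /forallP noB.
  apply/maxsetP; split=> // B Bcl SB; apply/eqP; rewrite finset.eqEsubset SB andbT.
  apply: contraR (noB B) => nBS; by rewrite Bcl properE SB.
case/andP=> Bcl /properP[SB [v vB vS]]; exists v; rewrite /extends SH vS /=.
apply/'forall_implyP => u uS.
move/'forall_implyP: Bcl => /(_ u (fintype.subsetP SB _ uS)).
move/'forall_implyP => /(_ v vB) /implyP; apply.
by apply: contraNneq vS => <-.
Qed.

(** For the trace [A] of a hyperedge on [v |: S], this counts the pairs [{u, v}] with [u] in [S]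
    that the hyperedge joins. *)
Definition star_weight (v : V) (A : {set V}) : nat :=
  if v \in A then #|A :\ v| else 0.

(** The full trace gets weight 0, because a hyperedge containing [S] cannot occur when [S] is
    spurious. *)
Definition pair_weight S (A : {set V}) : nat :=
  if A == S then 0 else 'C(#|A|, 2).

Lemma extends_weight H S v : extends H S v ->
  (#|S| <= \sum_(e in H) star_weight v (e :&: (v |: S)))%N.
Proof.
case/and3P=> SH vS /'forall_implyP adj.
apply: leq_trans (leq_card_cover (r := fun e u => (v \in e) && (u \in e)) (F := H) _) _.
  move=> u /adj /andP[_ /existsP[e /and3P[eH ue ve]]].
  by exists e => //; rewrite ve ue.
apply: leq_sum => e eH; rewrite /star_weight !inE eqxx andbT /=.
case: (v \in e) => /=; last first.
  by rewrite leqn0 cards_eq0; apply/eqP/setP => x; rewrite !inE andbF.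
apply/subset_leq_card/fintype.subsetP => u; rewrite !inE => /andP[uS ->].
by rewrite uS orbT !andbT; apply: contraNneq vS => <-.
Qed.

(** The objects covered are the two-element subsets of [S]. *)
Lemma spurious_weight H S : spurious H S ->
  ('C(#|S|, 2) <= \sum_(e in H) pair_weight S (e :&: S))%N.
Proof.
case/andP=> SH /maxsetP[Scl Smax].
rewrite -cards_draws.
apply: leq_trans (leq_card_cover (F := H)
  (r := fun e (P : {set V}) => (P \subset e) && (e :&: S != S)) _) _.
  move=> P; rewrite !inE => /andP[PS /cards2P[u [v [uv defP]]]].
  have uS : u \in S by apply: (fintype.subsetP PS); rewrite defP !inE eqxx.
  have vS : v \in S by apply: (fintype.subsetP PS); rewrite defP !inE eqxx orbT.
  move/'forall_implyP: Scl => /(_ u uS) /'forall_implyP /(_ v vS).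
  rewrite uv => /andP[_ /existsP[e /and3P[eH ue ve]]]; exists e => //.
  rewrite defP finset.subUset !finset.sub1set ue ve /=.
  (* A hyperedge containing [S] is a clique, so maximality makes it equal to [S], which is not in
     [H]. *)
  apply: contraNneq SH => /finset.setIidPr Se.
  by rewrite -(Smax e (hyperedge_clique eH) Se).
apply: leq_sum => e eH; rewrite /pair_weight.
case: ifP => eS.
  by rewrite leqn0 cards_eq0; apply/eqP/setP => x; rewrite !inE !andbF.
rewrite -cards_draws; apply/subset_leq_card/fintype.subsetP => P.
by rewrite !inE finset.subsetI => /andP[/andP[-> ->] /andP[->]].
Qed.

End Deterministic.

(** * The random hypergraph as a product measure *)

Section Expectation.
Variables (R : realType) (k : nat) (d : 'I_k -> nat) (n : nat) (p : 'I_k -> R).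
Hypothesis d_inj : injective d.
Hypothesis p01 : forall i, 0 <= p i <= 1.
Implicit Types (H : {set {set 'I_n}}) (e S U A : {set 'I_n}).
Local Notation E X := (@hypergraph_expectation R k d n p X).

(** Since [d] is injective, the sum has at most one term; it is 0 on sets that are not potential
    hyperedges. *)
Definition edge_prob e : R := \sum_(i < k | #|e| == d i) p i.

Lemma edge_probE i e : #|e| = d i -> edge_prob e = p i.
Proof.
move=> ei; rewrite /edge_prob (bigD1 i) ?ei//= big1 ?addr0// => i'.
by case/andP=> /eqP/d_inj ->; rewrite eqxx.
Qed.

Lemma edge_prob_out e : e \notin potential_hyperedges d n -> edge_prob e = 0.
Proof.
rewrite inE negb_exists => /forallP ne; rewrite /edge_prob big1 // => i.
by rewrite (negPf (ne i)).
Qed.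

Lemma edge_prob01 e : 0 <= edge_prob e <= 1.
Proof.
have [|/edge_prob_out ->] := boolP (e \in potential_hyperedges d n).
  by rewrite inE => /existsP[i /eqP/edge_probE ->].
by rewrite lexx ler01.
Qed.

(** With [edge_prob] vanishing elsewhere, the sum may run over all families of sets: a forbidden
    hyperedge brings a factor 0 when present and 1 when absent. *)
Lemma hypergraph_expectationE (X : {set {set 'I_n}} -> R) :
  E X = \sum_(H : {set {set 'I_n}}) (\prod_(e : {set 'I_n}) (if e \in H then edge_prob e else 1 - edge_prob e)) * X H.
Proof.
rewrite /hypergraph_expectation.
rewrite [RHS](bigID (fun H => H \subset potential_hyperedges d n))/=.
rewrite [X in _ = _ + X]big1 ?addr0; last first.
  move=> H /subsetPn[e eH /edge_prob_out eP].
  by rewrite (bigD1 e)//= eH eP !mul0r.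
apply: eq_bigr => H HP; congr (_ * _).
rewrite [RHS](bigID (mem (potential_hyperedges d n)))/=.
rewrite [X in _ = _ * X]big1 ?mulr1; last first.
  move=> e eP; rewrite (edge_prob_out eP) subr0.
  by case: ifPn => // eH; rewrite (fintype.subsetP HP _ eH) in eP.
rewrite /hypergraph_prob.
transitivity (\prod_(i < k) \prod_(e : {set 'I_n} | #|e| == d i)
    (if e \in H then edge_prob e else 1 - edge_prob e)).
  by apply: eq_bigr => i _; apply: eq_bigr => e /eqP/edge_probE ->.
rewrite (exchange_big_dep (mem (potential_hyperedges d n)))/=; last first.
  by move=> i e _ ei; rewrite inE; apply/existsP; exists i.
apply: eq_bigr => e; rewrite inE => /existsP[i ei].
rewrite (big_pred1 i)// => i' /=; rewrite (eqP ei) eq_sym.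
by apply/eqP/eqP => [/d_inj|->].
Qed.

Lemma hypergraph_expectation_le (X Y : {set {set 'I_n}} -> R) :
  (forall H, X H <= Y H) -> E X <= E Y.
Proof.
move=> XY; rewrite !hypergraph_expectationE; apply: ler_sum => H _; apply: ler_wpM2l => //.
apply: prodr_ge0 => e _; case/andP: (edge_prob01 e) => q0 q1.
by case: ifP => // _; rewrite subr_ge0.
Qed.

Lemma hypergraph_expectation_sum (I : Type) (r : seq I) (P : pred I)
    (X : I -> {set {set 'I_n}} -> R) :
  E (fun H => \sum_(i <- r | P i) X i H) = \sum_(i <- r | P i) E (X i).
Proof.
rewrite exchange_big /=; apply: eq_bigr => H _; exact: mulr_sumr.
Qed.

Lemma hypergraph_expectationD (X Y : {set {set 'I_n}} -> R) :
  E (fun H => X H + Y H) = E X + E Y.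
Proof. by rewrite -big_split; apply: eq_bigr => H _; rewrite mulrDr. Qed.

Lemma hypergraph_expectationZ (c : R) (X : {set {set 'I_n}} -> R) :
  E (fun H => c * X H) = c * E X.
Proof. by rewrite mulr_sumr; apply: eq_bigr => H _; rewrite mulrCA. Qed.

(** Independence: this is the expansion of a product of binary sums over all families [H]. *)
Lemma hypergraph_expectation_prod (a b : {set 'I_n} -> R) :
  E (fun H => \prod_(e : {set 'I_n}) (if e \in H then a e else b e))
  = \prod_(e : {set 'I_n}) (edge_prob e * a e + (1 - edge_prob e) * b e).
Proof.
rewrite hypergraph_expectationE bigA_distr; apply: eq_bigr => H _.
by rewrite -big_split; apply: eq_bigr => e _; case: ifP.
Qed.

Lemma hypergraph_expectation_mem S : E (fun H => (S \in H)%:R) = edge_prob S.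
Proof.
(* The indicator is itself a product over sets, whose only possible zero factor is at an absent
   [S]. *)
have -> : E (fun H => (S \in H)%:R) =
    E (fun H => \prod_(e : {set 'I_n}) (if e \in H then 1 else (e != S)%:R)).
  apply: eq_bigr => H _; congr (_ * _); rewrite (bigD1 S) //= eqxx.
  rewrite big1 ?mulr1; first by case: ifP.
  by move=> e ->; case: ifP.
rewrite hypergraph_expectation_prod (bigD1 S) //= eqxx mulr0 mulr1 addr0.
by rewrite big1 ?mulr1 // => e ->; rewrite !mulr1 addrC subrK.
Qed.

Lemma expectation_edges_of_degree j :
  E (fun H => #|edges_of_degree (d j) H|%:R) = 'C(n, d j)%:R * p j.
Proof.
transitivity (E (fun H => \sum_(S : {set 'I_n} | #|S| == d j) (S \in H)%:R)).
  apply: eq_bigr => H _; congr (_ * _).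
  rewrite -sum1_card natr_sum big_mkcond [RHS]big_mkcond /=.
  by apply: eq_bigr => S _; rewrite inE; case: (S \in H); case: ifP.
rewrite hypergraph_expectation_sum (eq_bigr (fun=> p j)); last first.
  by move=> S /eqP Sj; rewrite hypergraph_expectation_mem (edge_probE Sj).
rewrite sumr_const mulr_natl; congr (_ *+ _).
by rewrite -[in RHS](card_ord n) -card_draws; apply: eq_card => S; rewrite !inE.
Qed.

(** * Exponential moments of trace weights *)

Section Moment.
Variables (U : {set 'I_n}) (x : {set 'I_n} -> R).
Hypothesis x_ge0 : forall A, 0 <= x A.
Hypothesis xU : forall i A, A \subset U ->
  p i * n%:R ^+ d i * x A <= n%:R ^+ #|A|.

(** Hyperedges are grouped by degree and trace on [U]. By [card_supersets] and [xU], each of the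
    [k * 2 ^ #|U|] groups contributes at most 1. *)
Lemma sum_edge_prob_trace : (0 < n)%N ->
  \sum_(e : {set 'I_n}) edge_prob e * x (e :&: U) <= (k * 2 ^ #|U|)%:R.
Proof.
move=> n_gt0.
have -> : \sum_(e : {set 'I_n}) edge_prob e * x (e :&: U) =
    \sum_(i < k) \sum_(e : {set 'I_n} | #|e| == d i) p i * x (e :&: U).
  rewrite [RHS](exchange_big_dep predT) //=.
  by apply: eq_bigr => e _; rewrite -mulr_suml.
rewrite natrM mulr_natl -[X in _ *+ X](card_ord k) -sumr_const.
apply: ler_sum => i _.
rewrite (partition_big (fun e => e :&: U) (mem (powerset U))) /=; last first.
  by move=> e _; rewrite powersetE subsetIr.
rewrite -card_powerset -sumr_const; apply: ler_sum => A; rewrite powersetE => AU.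
have nA_gt0 : 0 < n%:R ^+ #|A| :> R by rewrite exprn_gt0 // ltr0n.
rewrite -(ler_pM2r nA_gt0) mul1r; apply: le_trans (xU i AU).
rewrite (eq_bigr (fun=> p i * x A)); last by move=> e /andP[_ /eqP ->].
rewrite sumr_const -[X in X * _]mulr_natr -[X in X <= _]mulrA [X in _ <= X]mulrAC.
apply: ler_wpM2l; first by rewrite mulr_ge0 //; case/andP: (p01 i).
rewrite -!natrX -natrM ler_nat.
apply: leq_trans (card_supersets (d i) A); rewrite leq_mul2r; apply/orP; right.
apply/subset_leq_card/fintype.subsetP => e; rewrite !inE => /andP[-> /eqP <-].
exact: subsetIl.
Qed.

Lemma prod_edge_prob_trace : (0 < n)%N ->
  \prod_(e : {set 'I_n}) (1 + edge_prob e * x (e :&: U)) <= expR (k * 2 ^ #|U|)%:R.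
Proof.
move=> n_gt0; apply: (@le_trans _ _ (expR (\sum_(e : {set 'I_n}) edge_prob e * x (e :&: U)))).
  rewrite expR_sum; apply: ler_prod => e _; rewrite expR_ge1Dx andbT.
  by rewrite addr_ge0 // mulr_ge0 //; case/andP: (edge_prob01 e).
by rewrite ler_expR sum_edge_prob_trace.
Qed.

End Moment.

Definition trace_moment (U : {set 'I_n}) (w : {set 'I_n} -> nat) (y : R) H : R :=
  y ^+ \sum_(e in H) w (e :&: U).

(** The second bound gains the factor [edge_prob S]: a set [S] of weight 0 does not affect the
    moment, so its presence is independent of it. *)
Lemma expectation_trace_moment U (w : {set 'I_n} -> nat) (y : R) :
  (0 < n)%N -> 1 <= y ->
  (forall i A, A \subset U -> (0 < w A)%N ->
     p i * n%:R ^+ d i * y ^+ w A <= n%:R ^+ #|A|) ->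
  E (trace_moment U w y) <= expR (k * 2 ^ #|U|)%:R /\
  forall S, w (S :&: U) = 0 ->
    E (fun H => (S \in H)%:R * trace_moment U w y H)
      <= edge_prob S * expR (k * 2 ^ #|U|)%:R.
Proof.
move=> n_gt0 y_ge1 wU.
(* The factor of [e] in the expected product is then [1 + edge_prob e * x (e :&: U)]. Traces of
   weight 0 give [x A = 0], so only positive weights need the hypothesis. *)
pose x A := y ^+ w A - 1.
have x_ge0 A : 0 <= x A by rewrite subr_ge0 exprn_ege1.
have xU i A : A \subset U -> p i * n%:R ^+ d i * x A <= n%:R ^+ #|A|.
  move=> AU; rewrite /x; case: (posnP (w A)) => [->|wA].
    by rewrite expr0 subrr mulr0 exprn_ge0.
  apply: le_trans (wU i A AU wA); apply: ler_wpM2l.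
    by rewrite mulr_ge0 ?exprn_ge0 //; case/andP: (p01 i).
  by rewrite lerBlDr lerDl.
have bound := prod_edge_prob_trace x_ge0 xU n_gt0.
have momentE H : trace_moment U w y H =
    \prod_(e : {set 'I_n}) (if e \in H then y ^+ w (e :&: U) else 1).
  by rewrite /trace_moment expr_sum big_mkcond.
have factorE e : edge_prob e * y ^+ w (e :&: U) + (1 - edge_prob e)
    = 1 + edge_prob e * x (e :&: U).
  by rewrite /x mulrBr mulr1 addrCA.
split.
  apply: le_trans bound; rewrite le_eqVlt; apply/orP; left; apply/eqP.
  transitivity (E (fun H => \prod_(e : {set 'I_n})
      (if e \in H then y ^+ w (e :&: U) else 1))).
    by apply: eq_bigr => H _; rewrite momentE.
  by rewrite hypergraph_expectation_prod; apply: eq_bigr => e _; rewrite mulr1 factorE.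
move=> S wS.
have -> : E (fun H => (S \in H)%:R * trace_moment U w y H) =
    E (fun H => \prod_(e : {set 'I_n})
      (if e \in H then y ^+ w (e :&: U) else (e != S)%:R)).
  apply: eq_bigr => H _; congr (_ * _); rewrite momentE.
  rewrite (bigD1 S) //= [RHS](bigD1 S) //= eqxx wS expr0.
  case: ifP => _; rewrite ?mul0r // !mul1r.
  by apply: eq_bigr => e ->.
rewrite hypergraph_expectation_prod (bigD1 S) //= eqxx wS expr0 mulr0 addr0 mulr1.
apply: ler_wpM2l; first by case/andP: (edge_prob01 S).
apply: le_trans bound; rewrite [X in _ <= X](bigD1 S) //=.
have -> : x (S :&: U) = 0 by rewrite /x wS expr0 subrr.
rewrite mulr0 addr0 mul1r le_eqVlt; apply/orP; left.
by apply/eqP; apply: eq_bigr => e ->; rewrite mulr1 factorE.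
Qed.

(** * Bounding the expected symmetric difference *)

Section SymmetricDifference.
Variables (j : 'I_k) (y z : R).
Hypotheses (n_gt0 : (0 < n)%N) (y_ge1 : 1 <= y) (z_ge1 : 1 <= z).
Hypothesis yP : forall i s, (0 < s <= d j)%N ->
  p i * n%:R ^+ d i * y ^+ s <= n%:R ^+ s.+1.
Hypothesis zP : forall i s, (1 < s < d j)%N ->
  p i * n%:R ^+ d i * z ^+ 'C(s, 2) <= n%:R ^+ s.

(** Markov's inequality with [U = v |: S]: the moment is at least [y ^+ d j] on the event. The
    factor [p j] comes from [S] itself, whose star weight is 0 because [v] is outside [S]. *)
Lemma expectation_extends S v : #|S| = d j ->
  E (fun H => (extends H S v)%:R)
    <= p j * expR (k * 2 ^ (d j).+1)%:R / y ^+ d j.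
Proof.
move=> Sj; have y_gt0 : 0 < y by apply: lt_le_trans y_ge1.
have [vS|vS] := boolP (v \in S).
  rewrite (_ : E _ = 0); last first.
    by apply: big1 => H _; rewrite /extends vS /= andbF mulr0.
  by rewrite divr_ge0 ?mulr_ge0 ?expR_ge0 ?exprn_ge0 ?(ltW y_gt0) //;
     case/andP: (p01 j).
have cU : #|v |: S| = (d j).+1 by rewrite cardsU1 vS Sj.
have [|_ /(_ S)] := @expectation_trace_moment (v |: S) (star_weight v) y n_gt0 y_ge1.
  move=> i A AU; rewrite /star_weight; case: ifP => // vA A_gt0.
  rewrite (cardsD1 v A) vA add1n; apply: yP; rewrite A_gt0 /= -ltnS.
  by rewrite -cU; apply: leq_trans (subset_leq_card AU); rewrite (cardsD1 v A) vA.
rewrite cU (edge_probE Sj) => bound.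
rewrite ler_pdivlMr ?exprn_gt0 // mulrC -hypergraph_expectationZ.
apply: le_trans (bound _); last by rewrite /star_weight inE (negPf vS).
apply: hypergraph_expectation_le => H.
case: (boolP (extends H S v)) => [ext|_]; last first.
  by rewrite mulr0 mulr_ge0 // exprn_ge0 // ltW.
have /andP[-> _] := ext; rewrite mul1r mulr1 /trace_moment -Sj.
by apply: ler_weXn2l => //; exact: extends_weight.
Qed.

Lemma expectation_spurious S : #|S| = d j ->
  E (fun H => (spurious H S)%:R)
    <= expR (k * 2 ^ d j)%:R / z ^+ 'C(d j, 2).
Proof.
move=> Sj; have z_gt0 : 0 < z by apply: lt_le_trans z_ge1.
have [|] := @expectation_trace_moment S (pair_weight S) z n_gt0 z_ge1.
  move=> i A AS; rewrite /pair_weight; case: ifPn => // AnS; rewrite bin_gt0 => A2.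
  apply: zP; rewrite A2 -Sj /=; apply: proper_card.
  by rewrite finset.properEneq AnS.
rewrite Sj => bound _.
rewrite ler_pdivlMr ?exprn_gt0 // mulrC -hypergraph_expectationZ.
apply: le_trans bound; apply: hypergraph_expectation_le => H.
case: (boolP (spurious H S)) => [sp|_]; last first.
  by rewrite mulr0 exprn_ge0 // ltW.
rewrite mulr1 /trace_moment -Sj.
by apply: ler_weXn2l => //; exact: spurious_weight.
Qed.

Lemma expectation_symdiff :
  E (fun H => #|symdiff (edges_of_degree (d j) H)
                 (maximal_cliques (projected_graph H) (d j))|%:R)
  <= 'C(n, d j)%:R * (n%:R * (p j * expR (k * 2 ^ (d j).+1)%:R / y ^+ d j)
       + expR (k * 2 ^ d j)%:R / z ^+ 'C(d j, 2)).
Proof.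
apply: (@le_trans _ _ (E (fun H => \sum_(S : {set 'I_n} | #|S| == d j)
    (\sum_(v : 'I_n) (extends H S v)%:R + (spurious H S)%:R)))).
  apply: hypergraph_expectation_le => H; apply: (le_trans (y := (\sum_(S : {set 'I_n} | #|S| == d j)
    (\sum_(v : 'I_n) extends H S v + spurious H S))%N%:R)).
    by rewrite ler_nat leq_symdiff.
  by rewrite natr_sum; apply: ler_sum => S _; rewrite natrD natr_sum.
have -> : 'C(n, d j) = #|[set S : {set 'I_n} | #|S| == d j]|.
  by rewrite card_draws card_ord.
rewrite hypergraph_expectation_sum mulr_natl -sumr_const.
rewrite [X in _ <= X](eq_bigl (fun S : {set 'I_n} => #|S| == d j)); last first.
  by move=> S; rewrite inE.
apply: ler_sum => S /eqP Sj.
rewrite hypergraph_expectationD hypergraph_expectation_sum; apply: lerD; last exact: expectation_spurious.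
rewrite mulr_natl -[X in _ *+ X](card_ord n) -sumr_const.
by apply: ler_sum => v _; apply: expectation_extends.
Qed.

End SymmetricDifference.

End Expectation.

(** * Choice of the exponents *)

(** The gap between the two sides is concave in [s] and nonnegative at [2] and [m]. Times [m - 2],
    it is the linear interpolation of the end values plus the term [h3]. *)
Lemma concave_exponent_bound (R : realFieldType) (c b m s : R) :
  0 <= c -> 2 <= s <= m -> b + c <= 2 -> b + c * (m * (m - 1) / 2) <= m ->
  b + c * (s * (s - 1) / 2) <= s.
Proof.
move=> c0 /andP[s2 sm] b2 bm.
have [m2|m2] := leP m 2.
  have -> : s = 2 by lra.
  lra.
have h1 : 0 <= (m - s) * (2 - b - c) by apply: mulr_ge0; lra.
have h2 : 0 <= (s - 2) * (m - b - c * (m * (m - 1) / 2)) by apply: mulr_ge0; lra.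
have h3 : 0 <= c / 2 * ((s - 2) * (m - s) * (m - 2)).
  by do ?apply: mulr_ge0; lra.
have m20 : 0 < m - 2 by lra.
rewrite -subr_ge0 -(pmulr_rge0 _ m20).
suff -> : (m - 2) * (s - (b + c * (s * (s - 1) / 2))) =
  (m - s) * (2 - b - c) + (s - 2) * (m - b - c * (m * (m - 1) / 2))
   + c / 2 * ((s - 2) * (m - s) * (m - 2)) by rewrite !addr_ge0.
by field.
Qed.

(** Here [D], [M], [dj] stand for [d j], the largest [delta i] and [delta j]; the bases will be
    [y = n^a] and [z = n^c], and [t] absorbs [eps]. The first constraint serves [yP], the third and
    fourth serve [zP] at sizes [2] and [D - 1]; the other two make each error smaller than the main
    term by [n^(-t)]. *)
Lemma threshold_exponents (R : realFieldType) (D M dj : R) :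
  3 <= D -> 0 < dj < 1 ->
  M < (D - 2) / D + 2 * dj / (D * (D - 1)) ->
  exists t a c : R, [/\ 0 < t, 0 <= a & 0 <= c] /\
   [/\ M + t + a <= 1, 1 + t <= a * D, 1 + M + t + c <= 2,
       1 + M + t + c * ((D - 1) * (D - 1 - 1) / 2) <= D - 1 &
       D - 1 - dj + 2 * t <= c * (D * (D - 1) / 2)].
Proof.
move=> D3 /andP[dj0 dj1] hM.
have DD : 0 < D * (D - 1) by apply: mulr_gt0; lra.
have {}hM : M * (D * (D - 1)) < (D - 2) * (D - 1) + 2 * dj.
  rewrite -ltr_pdivlMr //; apply: lt_le_trans hM _; rewrite le_eqVlt.
  by apply/orP; left; apply/eqP; field; apply/andP; split; lra.
(* With [a = 1 - M - t] and [c] making the last constraint an equality, [s1], [s2], [s3] are the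
   slacks at [t = 0] of the second, third and fourth constraints, up to positive factors. Positivity
   of [s2] is the hypothesis itself. *)
pose s1 := D * (1 - M) - 1.
pose s2 := D * (D - 1) * (1 - M) - 2 * (D - 1 - dj).
pose s3 := (D - 2) * (1 + dj) - D * M.
have hDM : M * D < D - 2 + dj.
  have D1 : 0 < D - 1 by lra.
  rewrite -(ltr_pM2r D1); apply: le_lt_trans (_ : _ <= M * (D * (D - 1))) _.
    by rewrite mulrA.
  apply: lt_le_trans hM _; nra.
have s1_gt0 : 0 < s1 by rewrite /s1; lra.
have s2_gt0 : 0 < s2 by rewrite /s2; lra.
have s3_gt0 : 0 < s3 by rewrite /s3; nra.
(* The divisor dominates the coefficient of [t] in all three constraints. *)
pose t := Num.min s1 (Num.min s2 s3) / (4 + D * D).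
have q_gt0 : 0 < 4 + D * D by nra.
have t_gt0 : 0 < t by rewrite divr_gt0 // !lt_min s1_gt0 s2_gt0.
have tE : t * (4 + D * D) = Num.min s1 (Num.min s2 s3) by rewrite divfK // gt_eqF.
have t1 : t * (4 + D * D) <= s1 by rewrite tE ge_min lexx.
have t2 : t * (4 + D * D) <= s2 by rewrite tE !ge_min lexx orbT.
have t3 : t * (4 + D * D) <= s3 by rewrite tE !ge_min lexx !orbT.
have D_gt0 : 0 < D by lra.
pose c := (D - 1 - dj + 2 * t) * 2 / (D * (D - 1)).
have cE : c * (D * (D - 1)) = (D - 1 - dj + 2 * t) * 2 by rewrite divfK // gt_eqF.
have aD : 1 + t <= (1 - M - t) * D.
  have : t * (D + 1) <= t * (4 + D * D) by apply: ler_wpM2l; nra.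
  rewrite /s1 in t1; lra.
exists t, (1 - M - t), c; split; split => //.
- by rewrite -(pmulr_lge0 _ D_gt0); lra.
- by rewrite divr_ge0 //; lra.
- lra.
- rewrite -(ler_pM2r DD).
  have : t * (4 + D * (D - 1)) <= t * (4 + D * D) by apply: ler_wpM2l; lra.
  rewrite /s2 in t2; lra.
- rewrite -(ler_pM2r D_gt0).
  have -> : (1 + M + t + c * ((D - 1) * (D - 1 - 1) / 2)) * D =
     (1 + M + t) * D + c * (D * (D - 1)) * (D - 2) / 2 by field.
  rewrite cE.
  have : t * (2 * (D - 2) + D) <= t * (4 + D * D) by apply: ler_wpM2l; nra.
  rewrite /s3 in t3; lra.
- lra.
Qed.

(** * Asymptotics and conclusion *)

Local Open Scope classical_set_scope.

Lemma cvg_natr_powRN (R : realType) (t : R) : 0 < t ->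
  n%:R `^ (- t) @[n --> \oo] --> (0 : R).
Proof.
move=> t0; under eq_fun do rewrite powRN.
apply/gtr0_cvgV0.
  by near=> n; apply: powR_gt0; rewrite ltr0n; near: n; exists 1%N.
apply/cvgryPge => A; near=> n.
have An : (Num.max A 1) `^ t^-1 <= n%:R by near: n; exact: nbhs_infty_ger.
apply: le_trans (_ : Num.max A 1 <= _); first by rewrite le_max lexx.
have A0 : 0 <= Num.max A 1 by rewrite le_max ler01 orbT.
have maxE : (Num.max A 1 `^ t^-1) `^ t = Num.max A 1.
  by rewrite -powRrM mulVf ?lt0r_neq0 // powRr1.
rewrite -[leLHS]maxE.
by apply: ge0_ler_powR; rewrite ?nnegrE ?powR_ge0 // ltW.
Unshelve. all: by end_near.
Qed.

Lemma natr_bin2 (R : realFieldType) (s : nat) :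
  'C(s, 2)%:R = s%:R * (s%:R - 1) / 2 :> R.
Proof.
case: s => [|s]; first by rewrite bin0n !mul0r.
have /(congr1 (fun m => m%:R : R)) := mul_bin_diag s.+1 1.
by rewrite bin1 /= !natrM -natr1 => h; lra.
Qed.

Lemma exprn_powR (R : realType) (x a : R) (s : nat) :
  (x `^ a) ^+ s = x `^ (a * s%:R).
Proof. by rewrite powRrM powR_mulrn // powR_ge0. Qed.

Theorem theorem1 (R : realType) (k : nat) (d : 'I_k -> nat)
    (delta : 'I_k -> R) (p eps : 'I_k -> nat -> R) (j : 'I_k) :
  (1 <= k)%N ->
  (forall i, (2 <= d i)%N) ->
  (forall i i' : 'I_k, (i < i')%N -> (d i < d i')%N) ->
  (forall i, 0 < delta i < 1) ->
  (forall i n, 0 <= p i n <= 1) ->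
  (forall i, eps i n @[n --> \oo] --> (0 : R)) ->
  (forall i, \forall n \near \oo,
     p i n = n%:R `^ (1 - (d i)%:R + delta i + eps i n)) ->
  (3 <= d j)%N ->
  \big[Num.max/delta j]_(i < k) delta i
    < ((d j)%:R - 2) / (d j)%:R
      + 2 * delta j / ((d j)%:R * ((d j)%:R - 1)) ->
  exists2 eta : nat -> R, eta n @[n --> \oo] --> (0 : R) &
    \forall n \near \oo,
      hypergraph_expectation d (p^~ n) (fun H : {set {set 'I_n}} =>
        #|symdiff (edges_of_degree (d j) H)
                  (maximal_cliques (projected_graph H) (d j))|%:R)
      = eta n *
        hypergraph_expectation d (p^~ n) (fun H : {set {set 'I_n}} =>
          #|edges_of_degree (d j) H|%:R).
Proof.
move=> _ _ d_incr delta01 p01 eps0 pE dj3 hM.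
have d_inj : injective d.
  move=> i i' dii'; apply: val_inj; case: (ltngtP i i') => // /d_incr.
    by rewrite dii' ltnn.
  by rewrite dii' ltnn.
set M := \big[Num.max/delta j]_(i < k) delta i in hM.
have leM i : delta i <= M by apply: le_bigmax.
have D3 : 3 <= (d j)%:R :> R by rewrite (ler_nat _ 3).
have [t [a [c [[t0 a0 c0] [ha haD hc hcm hcD]]]]] :=
  threshold_exponents D3 (delta01 j) hM.
pose X n : R := hypergraph_expectation d (p^~ n) (fun H : {set {set 'I_n}} =>
  #|symdiff (edges_of_degree (d j) H)
            (maximal_cliques (projected_graph H) (d j))|%:R).
pose Y n : R := hypergraph_expectation d (p^~ n) (fun H : {set {set 'I_n}} =>
  #|edges_of_degree (d j) H|%:R).
pose K1 : R := expR (k * 2 ^ (d j).+1)%:R.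
pose K2 : R := expR (k * 2 ^ d j)%:R.
have pE' : \forall n \near \oo, forall i,
    p i n = n%:R `^ (1 - (d i)%:R + delta i + eps i n).
  exact: filter_forall.
have epst : \forall n \near \oo, forall i, `|eps i n| <= t.
  by apply: filter_forall => i; apply: (cvgr0Pnorm_le _).1 => //; exact: eps0.
have YE n : Y n = 'C(n, d j)%:R * p j n by exact: expectation_edges_of_degree.
have Y_gt0 : \forall n \near \oo, 0 < Y n.
  near=> n; rewrite YE; apply: mulr_gt0.
    by rewrite ltr0n bin_gt0; near: n; exists (d j).
  have -> : p j n = n%:R `^ (1 - (d j)%:R + delta j + eps j n).
    by move: (j); near: n.
  by apply: powR_gt0; rewrite ltr0n; near: n; exists 1%N.
(* The ratio is squeezed between 0 and [(K1 + K2) * n^(-t)]. *)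
exists (fun n => X n / Y n); last first.
  by near=> n; rewrite -/(X n) -/(Y n) divfK // gt_eqF //; near: n.
have cvgK : (K1 + K2) * n%:R `^ (- t) @[n --> \oo] --> (0 : R).
  by rewrite -(mulr0 (K1 + K2)); apply: cvgMr; exact: cvg_natr_powRN.
apply: squeeze_cvgr (@cvg_cst _ _ _ _ _) cvgK.
near=> n.
have n_gt0 : (0 < n)%N by near: n; exists 1%N.
have N1 : 1 <= n%:R :> R by rewrite ler1n.
have N0 : 0 < n%:R :> R by rewrite ltr0n.
have Nn0 : n%:R != 0 :> R by rewrite gt_eqF.
have Y0 : 0 < Y n by near: n.
have pn i : p i n = n%:R `^ (1 - (d i)%:R + delta i + eps i n).
  by move: i; near: n.
have et i : `|eps i n| <= t by move: i; near: n.
have addP (x y : R) : n%:R `^ x * n%:R `^ y = n%:R `^ (x + y).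
  by rewrite powRD // Nn0 implybT.
have expP m : n%:R ^+ m = n%:R `^ m%:R :> R by rewrite powR_mulrn // ltW.
apply/andP; split.
  apply: divr_ge0; last exact: ltW.
  rewrite -[leLHS](@hypergraph_expectation_cst R k d n (p^~ n) 0 d_inj) /X.
  by apply: (hypergraph_expectation_le d_inj (p01^~ n)) => H; exact: ler0n.
have yP i s : (0 < s <= d j)%N ->
    p i n * n%:R ^+ d i * (n%:R `^ a) ^+ s <= n%:R ^+ s.+1.
  case/andP=> s0 _; rewrite pn !expP exprn_powR !addP; apply: ler_powR => //.
  have := et i; rewrite ler_norml => /andP[_ ei].
  have := leM i; rewrite -natr1.
  have s1 : 1 <= s%:R :> R by rewrite ler1n.
  (* Since [a <= 1], the exponent inequality for [s] follows from the case [s = 1], which is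
     [ha]. *)
  have : 0 <= (1 - a) * (s%:R - 1) by apply: mulr_ge0; have := leM j; case/andP: (delta01 j); lra.
  lra.
have zP i s : (1 < s < d j)%N ->
    p i n * n%:R ^+ d i * (n%:R `^ c) ^+ 'C(s, 2) <= n%:R ^+ s.
  case/andP=> s2 sd; rewrite pn !expP exprn_powR !addP; apply: ler_powR => //.
  have := et i; rewrite ler_norml => /andP[_ ei].
  have := leM i; rewrite natr_bin2.
  have sm : 2 <= (s%:R : R) <= (d j)%:R - 1.
    apply/andP; split; first by rewrite (ler_nat _ 2).
    have : s.+1%:R <= (d j)%:R :> R by rewrite ler_nat.
    by rewrite -natr1; lra.
  have := concave_exponent_bound c0 sm hc hcm; lra.
have y_ge1 : 1 <= n%:R `^ a by rewrite -[leLHS](powRr0 n%:R) ler_powR.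
have z_ge1 : 1 <= n%:R `^ c by rewrite -[leLHS](powRr0 n%:R) ler_powR.
have := @expectation_symdiff _ _ d n (p^~ n) d_inj (p01^~ n) j _ _ n_gt0
  y_ge1 z_ge1 yP zP.
rewrite -/(X n) -/K1 -/K2 => XB; rewrite ler_pdivrMr //.
(* After cancelling ['C(n, d j)], each of the two error terms is compared with its constant times
   [p j n * n^(-t)]. *)
apply: le_trans XB _; rewrite YE [leRHS]mulrCA; apply: ler_wpM2l => //.
rewrite [leRHS]mulrAC !mulrDl; apply: lerD.
  rewrite exprn_powR.
  have -> : n%:R * (p j n * K1 / n%:R `^ (a * (d j)%:R)) =
      K1 * p j n * n%:R `^ (1 - a * (d j)%:R).
    rewrite powRD ?Nn0 ?implybT // powRr1 ?(ltW N0) // powRN; ring.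
  apply: ler_wpM2l; first by rewrite mulr_ge0 ?expR_ge0 //; case/andP: (p01 j n).
  by apply: ler_powR => //; lra.
rewrite exprn_powR -powRN -mulrA ler_wpM2l ?expR_ge0 //.
(* One [t] in [hcD] pays for [eps j n >= - t], the other for the factor [n^(-t)]. *)
rewrite pn addP natr_bin2; apply: ler_powR => //.
have := et j; rewrite ler_norml => /andP[ei _]; lra.
Unshelve. all: by end_near.
Qed.
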